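(* Let $f(z)=\sum_{k=0}^\infty a_k z^k$, with $a_k>0$ for all $k\ge 0$, be an entire function belonging to the Laguerre-Pólya class, and for $n\ge 2$ put $q_n(f)=\frac{a_{n-1}^2}{a_{n-2}a_n}$. If $q_2(f)<4$ and $q_2(f)\leq q_3(f)$, then $$q_3(f)\leq \frac{-q_2(f)\,(2q_2(f)-9)+2(q_2(f)-3)\sqrt{q_2(f)(q_2(f)-3)}}{q_2(f)\,(4-q_2(f))}.$$
   Context: A real entire function $f$ belongs to the Laguerre-Pólya class ($f\in\mathcal{L-P}$) if it can be expressed in the form $f(x)=c x^n e^{-\alpha x^2+\beta x}\prod_{k=1}^\infty\left(1-\frac{x}{x_k}\right)e^{x x_k^{-1}}$, where $c,\alpha,\beta,x_k\in\mathbb{R}$, $x_k\neq 0$, $\alpha\ge 0$, $n$ is a nonnegative integer and $\sum_{k=1}^\infty x_k^{-2}<\infty$; the product may be finite or empty (in the latter case it equals $1$). *)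

(* Defs.v *)
(* Stdlib reals, with Coquelicot for complex numbers, limits and power series. *)
From Stdlib Require Import Reals.
From Coquelicot Require Import Coquelicot.
Open Scope R_scope.

(* [f] is the sum of [sum_k a_k z^k], convergent at every complex [z]; hence
   [f] is entire with real Taylor coefficients [a]. *)
Definition is_entire_series (a : nat -> R) (f : C -> C) : Prop :=
  forall z : C,
    is_pseries (K := C_AbsRing) (V := C_NormedModule)
      (fun k => RtoC (a k)) z (f z).

Definition real_entire (f : C -> C) : Prop :=
  exists a : nat -> R, is_entire_series a f.

Definition Cexp (z : C) : C :=
  (exp (Re z) * cos (Im z), exp (Re z) * sin (Im z)).

(* [Cprod u N] is [u 0 * ... * u (N - 1)]; in particular [Cprod u 0 = 1]. *)
Fixpoint Cprod (u : nat -> C) (N : nat) : C :=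
  match N with
  | O => RtoC 1
  | S m => Cmult (Cprod u m) (u m)
  end.

Definition LP_factor (r : R) (z : C) : C :=
  ((1 - z / r) * Cexp (z / r))%C.

Definition finite_LP_product (P : C -> C) : Prop :=
  exists (N : nat) (x : nat -> R),
    (forall k, (k < N)%nat -> x k <> 0) /\
    (forall z : C, P z = Cprod (fun k => LP_factor (x k) z) N).

(* Infinite products are limits of partial products, and the limit may be [0]:
   [P] vanishes at every [x k]. *)
Definition infinite_LP_product (P : C -> C) : Prop :=
  exists x : nat -> R,
    (forall k, x k <> 0) /\
    ex_series (fun k => / (x k) ^ 2) /\
    (forall z : C,
       filterlim (fun N => Cprod (fun k => LP_factor (x k) z) N)
         eventually (locally (P z))).

Definition Laguerre_Polya (f : C -> C) : Prop :=
  real_entire f /\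
  exists (c alpha beta : R) (n : nat) (P : C -> C),
    0 <= alpha /\
    (finite_LP_product P \/ infinite_LP_product P) /\
    (forall z : C,
       f z = (c * z ^ n * Cexp (- alpha * z ^ 2 + beta * z) * P z)%C).

(* Meaningful for [n >= 2] only, the subtractions being truncated. *)
Definition second_quotient (a : nat -> R) (n : nat) : R :=
  (a (n - 1)%nat) ^ 2 / (a (n - 2)%nat * a n).

(* Main.v *)
(* Since [f >= a 0] on the positive axis while [(1 + s) exp (- s) <= 1] for
   [s >= 0], all zeros are negative, there is no Gaussian factor, and
   [f (- x) / a 0 = exp (- g x) * prod_k (1 - r k x)] with [g >= 0] and
   [sum_k r k] finite.  The ratios [a j / a 0] are then the "elementary symmetric
   functions" [e j] of the [r k], the factor [exp (- g x)] being a limit of further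
   products [(1 - g x / m) ^ m].  Cauchy-Schwarz for the power sums, together with
   [q2 <= q3], gives [q2 >= 3].  If [x] is the inverse of the largest [r k], then
   [f (- x) = 0], so Bonferroni's inequality gives
   [1 - e 1 x + e 2 x ^ 2 - e 3 x ^ 3 <= 0].  With [y = e 2 x / e 1 <= 1] this reads
   [q3 <= q2 y ^ 3 / (1 - q2 y + q2 y ^ 2)], and the claimed bound is the maximum of
   the right-hand side over [0 < y <= 1], attained at [y = 1 - sqrt (1 - 3 / q2)]. *)
Require Import Defs.
From Stdlib Require Import Reals Factorial Lra Lia Classical_Pred_Type.
From Coquelicot Require Import Coquelicot.
Open Scope R_scope.

(** * Inequalities between the quotients [q2] and [q3] *)

Lemma cubic_at_small_root_bound (a b y : R) :
  3 <= a < 4 -> 0 < y <= 1 ->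
  b * (1 - a * y + a * y ^ 2) <= a * y ^ 3 ->
  b <= (- a * (2 * a - 9) + 2 * (a - 3) * sqrt (a * (a - 3))) / (a * (4 - a)).
Proof.
intros [Ha3 Ha4] [Hy0 Hy1] Hb.
(* This parameter removes the square root: [a = 3 / (1 - r ^ 2)] and [sqrt (a * (a - 3)) = a * r],
   so the claimed bound becomes [3 * (1 - r) ^ 2 / (1 - 2 * r)]. The condition [a < 4] means
   [r < 1 / 2]. *)
set (r := sqrt (1 - 3 / a)).
assert (H1 : 0 <= 1 - 3 / a < 1 / 4).
{ split; [apply Rmult_le_reg_r with a | apply Rmult_lt_reg_r with a];
    try lra; field_simplify; lra. }
assert (Hr0 : 0 <= r) by apply sqrt_pos.
assert (Hr2 : r * r = 1 - 3 / a) by (apply sqrt_sqrt; lra).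
assert (Hr1 : r < 1 / 2) by nra.
assert (Hs : sqrt (a * (a - 3)) = a * r).
{ apply sqrt_lem_1; [nra | nra |].
  replace (a * r * (a * r)) with (a * a * (r * r)) by ring.
  rewrite Hr2; field; lra. }
assert (Har : a * (1 - r * r) = 3) by (rewrite Hr2; field; lra).
assert (Ea : a = 3 / (1 - r * r)) by (apply Rmult_eq_reg_r with (1 - r * r); [field_simplify; nra | nra]).
rewrite Hs.
replace ((- a * (2 * a - 9) + 2 * (a - 3) * (a * r)) / (a * (4 - a)))
  with (3 * (1 - r) ^ 2 / (1 - 2 * r)).
2:{ rewrite Ea; field; repeat split; nra. }
set (D := 1 - a * y + a * y ^ 2) in *.
assert (HD : 0 < D).
{ unfold D. assert (y * (1 - y) <= 1 / 4) by (pose proof (pow2_ge_0 (y - 1 / 2)); nra). nra. }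
(* The cubic [3 (1-r)^2 D - a (1-2r) y^3] has the double root [y = 1 - r]. *)
assert (Hkey : a * y ^ 3 * (1 - 2 * r) <= 3 * (1 - r) ^ 2 * D).
{ assert (E : 3 * (1 - r) ^ 2 * D - a * y ^ 3 * (1 - 2 * r)
     = a * ((y - (1 - r)) ^ 2 * ((1 - r) * (1 + r) - (1 - 2 * r) * y))).
  { unfold D. rewrite Ea; field; nra. }
  (* Since [y <= 1], the linear factor is at least [r * (2 - r)]. *)
  assert (0 <= a * ((y - (1 - r)) ^ 2 * ((1 - r) * (1 + r) - (1 - 2 * r) * y))).
  { apply Rmult_le_pos; [lra | apply Rmult_le_pos; [apply pow2_ge_0 | nra]]. }
  lra. }
apply Rmult_le_reg_r with (D * (1 - 2 * r)); [nra |].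
replace (3 * (1 - r) ^ 2 / (1 - 2 * r) * (D * (1 - 2 * r))) with (3 * (1 - r) ^ 2 * D)
  by (field; lra).
nra.
Qed.

(* [c1, c2, c3] play the elementary symmetric functions of the numbers
   [1 / |zero|], so that [c1 ^ 2 - 2 c2] and [c1 ^ 3 - 3 c1 c2 + 3 c3] are power sums. *)
Lemma second_quotient_ge_3 (c1 c2 c3 : R) :
  0 < c1 -> 0 < c2 -> 0 < c3 ->
  0 <= c1 ^ 2 - 2 * c2 ->
  (forall t, 0 <= c1 * t ^ 2 - 2 * t * (c1 ^ 2 - 2 * c2) + (c1 ^ 3 - 3 * c1 * c2 + 3 * c3)) ->
  c1 ^ 2 / c2 <= c2 ^ 2 / (c1 * c3) ->
  3 <= c1 ^ 2 / c2.
Proof.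
intros H1 H2 H3 HS Hq Hle.
set (a := c1 ^ 2 / c2) in *.
assert (E2 : c2 = c1 ^ 2 / a) by (unfold a; field; split; lra).
assert (Ha : 2 <= a).
{ unfold a. apply Rmult_le_reg_r with c2; [lra|]. field_simplify; lra. }
set (b := c2 ^ 2 / (c1 * c3)) in *.
assert (E3 : c3 = c1 ^ 3 / (a ^ 2 * b)).
{ unfold a, b; field; repeat split; lra. }
(* The minimizer of the quadratic in [t], which yields (4 - a) b <= 3. *)
specialize (Hq (c1 * (1 - 2 / a))).
rewrite E3, E2 in Hq.
assert (H : 0 <= c1 ^ 3 * ((3 - (4 - a) * b) / (a ^ 2 * b))).
{ eapply Rle_trans; [apply Hq|]. right. field; lra. }
assert (Hc : 0 < c1 ^ 3) by (apply pow_lt; lra).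
assert (Hab : 0 < a ^ 2 * b) by (apply Rmult_lt_0_compat; [apply pow_lt|]; lra).
assert (H' : 0 <= 3 - (4 - a) * b).
{ destruct (Rle_lt_dec 0 (3 - (4 - a) * b)) as [?|Hn]; [assumption|exfalso].
  assert (0 < / (a ^ 2 * b)) by (apply Rinv_0_lt_compat; lra).
  unfold Rdiv in H. nra. }
(* As [a <= b], the bound on [(4 - a) * b] gives [(a - 1) * (a - 3) >= 0], and [a >= 2] rules out
   the lower range. *)
destruct (Rle_lt_dec 3 a); [assumption|exfalso]. nra.
Qed.

(** * Taylor coefficients of an exponential times a product *)

Fixpoint Rprod (u : nat -> R) (N : nat) : R :=
  match N with
  | O => 1
  | S m => Rprod u m * u m
  end.

Fixpoint Rsum (u : nat -> R) (N : nat) : R :=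
  match N with
  | O => 0
  | S m => Rsum u m + u m
  end.

(* [(-1) ^ j * expsym g r N j] is the [j]-th Taylor coefficient of
   [exp (- g x) * (1 - r 0 x) * ... * (1 - r (N - 1) x)]. *)
Fixpoint expsym (g : R) (r : nat -> R) (N j : nat) : R :=
  match N with
  | O => g ^ j / INR (fact j)
  | S m =>
      match j with
      | O => 1
      | S i => expsym g r m (S i) + r m * expsym g r m i
      end
  end.

Lemma expsym_0 g r N : expsym g r N 0 = 1.
Proof. destruct N; simpl; [field | reflexivity]. Qed.

Lemma expsym_S g r N j :
  expsym g r (S N) (S j) = expsym g r N (S j) + r N * expsym g r N j.
Proof. reflexivity. Qed.

Lemma Rsum_ge_0 r N : (forall k, 0 <= r k) -> 0 <= Rsum r N.
Proof. intros Hr; induction N; simpl; [lra | specialize (Hr N); lra]. Qed.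

(** The induction step is [B ^ (j + 1) + s * B ^ j <= (B + s) ^ (j + 1)]. When the sums of [r] are
    bounded, the estimate is uniform in [N], so each coefficient, being monotone in [N],
    converges. *)
Lemma expsym_bounds g r N j :
  0 <= g -> (forall k, 0 <= r k) ->
  0 <= expsym g r N j <= (g + Rsum r N) ^ j.
Proof.
intros Hg Hr. revert j; induction N as [|N IH]; intros j.
- simpl expsym. assert (Hf : 1 <= INR (fact j)).
  { apply (le_INR 1), lt_O_fact. }
  assert (Hp : 0 <= g ^ j) by (apply pow_le; lra).
  split.
  + apply Rmult_le_pos; [lra|]. left; apply Rinv_0_lt_compat; lra.
  + replace (g + Rsum r 0) with g by (simpl; ring).
    apply Rmult_le_reg_r with (INR (fact j)); [lra|].
    unfold Rdiv; rewrite Rmult_assoc, Rinv_l by lra. nra.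
- destruct j as [|j]; [simpl; lra|].
  rewrite expsym_S. destruct (IH j), (IH (S j)).
  pose proof (Hr N). pose proof (Rsum_ge_0 r N Hr).
  split; [nra|].
  change (Rsum r (S N)) with (Rsum r N + r N).
  set (B := g + Rsum r N) in *.
  replace (g + (Rsum r N + r N)) with (B + r N) by (unfold B; ring).
  assert (B ^ j <= (B + r N) ^ j) by (apply pow_incr; unfold B; lra).
  simpl in *.
  assert (0 <= B) by (unfold B; lra). nra.
Qed.

Lemma expsym_cvg g r B j :
  0 <= g -> (forall k, 0 <= r k) -> (forall N, Rsum r N <= B) ->
  exists l : R, is_lim_seq (fun N => expsym g r N j) l.
Proof.
intros Hg Hr HB.
destruct (ex_finite_lim_seq_incr (fun N => expsym g r N j) ((g + B) ^ j)) as [l Hl].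
- intros N. destruct j as [|j]; [rewrite !expsym_0; lra|].
  rewrite expsym_S. pose proof (proj1 (expsym_bounds g r N j Hg Hr)).
  pose proof (Hr N). nra.
- intros N. eapply Rle_trans; [apply expsym_bounds; assumption|].
  apply pow_incr. pose proof (Rsum_ge_0 r N Hr). specialize (HB N). lra.
- exists l; exact Hl.
Qed.

(** Up to sign, each Taylor remainder vanishes at [0] and has the previous one as its derivative, so
    nonnegativity propagates from [1 - exp (- x)]. *)
Lemma exp_neg_taylor_bounds t : 0 <= t ->
  1 - t + t ^ 2 / 2 - t ^ 3 / 6 <= exp (- t)
  <= 1 - t + t ^ 2 / 2 - t ^ 3 / 6 + t ^ 4 / 24.
Proof.
assert (mono : forall f f' : R -> R, (forall x, is_derive f x (f' x)) -> f 0 = 0 ->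
   (forall x, 0 <= x -> 0 <= f' x) -> forall x, 0 <= x -> 0 <= f x).
{ intros f f' Hd H0 Hp x Hx.
  destruct (MVT_gen f 0 x f') as [c [Hc E]].
  - intros; apply Hd.
  - intros y _; apply continuity_pt_filterlim.
    apply @ex_derive_continuous. eexists; apply Hd.
  - rewrite Rmin_left, Rmax_right in Hc by lra.
    assert (0 <= f' c) by (apply Hp; lra). nra. }
assert (P0 : forall x, 0 <= x -> 0 <= 1 - exp (- x)).
{ intros x Hx. rewrite <- exp_0 at 1.
  destruct (Req_dec x 0) as [->|]; [rewrite Ropp_0; lra|].
  left; apply Rlt_0_minus, exp_increasing; lra. }
assert (P1 : forall x, 0 <= x -> 0 <= exp (- x) - (1 - x)).
{ apply mono with (fun x => 1 - exp (- x)); auto.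
  - intros; auto_derive; [trivial | ring].
  - rewrite Ropp_0, exp_0; ring. }
assert (P2 : forall x, 0 <= x -> 0 <= 1 - x + x ^ 2 / 2 - exp (- x)).
{ apply mono with (fun x => exp (- x) - (1 - x)); auto.
  - intros; auto_derive; [trivial | field].
  - rewrite Ropp_0, exp_0; field. }
assert (P3 : forall x, 0 <= x -> 0 <= exp (- x) - (1 - x + x ^ 2 / 2 - x ^ 3 / 6)).
{ apply mono with (fun x => 1 - x + x ^ 2 / 2 - exp (- x)); auto.
  - intros; auto_derive; [trivial | field].
  - rewrite Ropp_0, exp_0; field. }
assert (P4 : forall x, 0 <= x ->
  0 <= 1 - x + x ^ 2 / 2 - x ^ 3 / 6 + x ^ 4 / 24 - exp (- x)).
{ apply mono with (fun x => exp (- x) - (1 - x + x ^ 2 / 2 - x ^ 3 / 6)); auto.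
  - intros; auto_derive; [trivial | field].
  - rewrite Ropp_0, exp_0; field. }
intros Ht. specialize (P3 t Ht). specialize (P4 t Ht). lra.
Qed.

(* Bonferroni's inequalities, which persist in the presence of the factor [exp (- g x)]. *)
Lemma bonferroni g r N x :
  0 <= g -> (forall k, 0 <= r k) -> 0 <= x -> (forall k, r k * x <= 1) ->
  1 - expsym g r N 1 * x + expsym g r N 2 * x ^ 2 - expsym g r N 3 * x ^ 3
  <= exp (- g * x) * Rprod (fun k => 1 - r k * x) N
  <= 1 - expsym g r N 1 * x + expsym g r N 2 * x ^ 2 - expsym g r N 3 * x ^ 3
     + expsym g r N 4 * x ^ 4.
Proof.
intros Hg Hr Hx Hrx. induction N as [|N IH].
- assert (H := exp_neg_taylor_bounds (g * x) (Rmult_le_pos _ _ Hg Hx)).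
  simpl in *. replace (- g * x) with (- (g * x)) by ring. lra.
- rewrite !expsym_S, expsym_0.
  simpl Rprod. rewrite <- Rmult_assoc.
  set (G := exp (- g * x) * Rprod _ N) in *.
  pose proof (proj1 (expsym_bounds g r N 3 Hg Hr)).
  pose proof (proj1 (expsym_bounds g r N 4 Hg Hr)).
  set (e1 := expsym g r N 1) in *. set (e2 := expsym g r N 2) in *.
  set (e3 := expsym g r N 3) in *. set (e4 := expsym g r N 4) in *.
  specialize (Hr N). specialize (Hrx N). set (s := r N) in *.
  destruct IH as [IH1 IH2].
  assert (Hs : 0 <= 1 - s * x) by lra.
  apply Rmult_le_compat_r with (r := 1 - s * x) in IH1, IH2; try assumption.
  assert (0 <= s * e3 * x ^ 4) by (apply Rmult_le_pos; [apply Rmult_le_pos | apply pow_le]; assumption).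
  assert (0 <= s * e4 * x ^ 5) by (apply Rmult_le_pos; [apply Rmult_le_pos | apply pow_le]; assumption).
  split; nra.
Qed.

(** The first expression is the sum of the [r k ^ 2], and the quadratic in [t] is [g * t ^ 2] plus
    the sum of the [r k * (t - r k) ^ 2]. Its nonnegativity for all [t] encodes Cauchy-Schwarz. *)
Lemma expsym_power_sums g r N t : 0 <= g -> (forall k, 0 <= r k) ->
  let e1 := expsym g r N 1 in
  let e2 := expsym g r N 2 in
  let e3 := expsym g r N 3 in
  0 <= e1 ^ 2 - 2 * e2 /\
  0 <= e1 * t ^ 2 - 2 * t * (e1 ^ 2 - 2 * e2) + (e1 ^ 3 - 3 * e1 * e2 + 3 * e3).
Proof.
intros Hg Hr; induction N as [|N [IH1 IH2]]; cbv zeta.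
- simpl. split; [lra | field_simplify]. nra.
- rewrite !expsym_S, expsym_0.
  set (e1 := expsym g r N 1) in *. set (e2 := expsym g r N 2) in *.
  set (e3 := expsym g r N 3) in *. specialize (Hr N). set (s := r N) in *.
  assert (0 <= s * (t - s) ^ 2) by (apply Rmult_le_pos; [|apply pow2_ge_0]; assumption).
  assert (0 <= s ^ 2) by apply pow2_ge_0.
  split; nra.
Qed.

(** The left side is the sum of the [r k ^ 2], and [r k ^ 2 <= M * r k]. The case [M = 0] will show
    that some [r k] is positive; [M = r m], the maximum, will locate the smallest root. *)
Lemma expsym_sum_squares_le g r N M : 0 <= g -> (forall k, 0 <= r k <= M) ->
  expsym g r N 1 ^ 2 - 2 * expsym g r N 2 <= M * expsym g r N 1.
Proof.
intros Hg Hr; induction N as [|N IH].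
- simpl. specialize (Hr O). field_simplify. nra.
- rewrite !expsym_S, expsym_0. specialize (Hr N). nra.
Qed.

(** All four properties are closed inequalities between convergent sequences. The upper bound with
    [e4] leaves an error of order [x ^ 4], which allows [e1], [e2], [e3] to be identified with
    Taylor coefficients. *)
Lemma expsym_limits g r B (F : R -> R) :
  0 <= g -> (forall k, 0 <= r k) -> (forall N, Rsum r N <= B) ->
  (forall x, 0 <= x ->
     is_lim_seq (fun N => exp (- g * x) * Rprod (fun k => 1 - r k * x) N) (F x)) ->
  exists e1 e2 e3 e4 : R,
    0 <= e1 ^ 2 - 2 * e2 /\
    (forall t, 0 <= e1 * t ^ 2 - 2 * t * (e1 ^ 2 - 2 * e2) + (e1 ^ 3 - 3 * e1 * e2 + 3 * e3)) /\
    (forall M, (forall k, r k <= M) -> e1 ^ 2 - 2 * e2 <= M * e1) /\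
    (forall x, 0 <= x -> (forall k, r k * x <= 1) ->
       1 - e1 * x + e2 * x ^ 2 - e3 * x ^ 3 <= F x
       <= 1 - e1 * x + e2 * x ^ 2 - e3 * x ^ 3 + e4 * x ^ 4).
Proof.
intros Hg Hr HB HF.
destruct (expsym_cvg g r B 1 Hg Hr HB) as [e1 H1].
destruct (expsym_cvg g r B 2 Hg Hr HB) as [e2 H2].
destruct (expsym_cvg g r B 3 Hg Hr HB) as [e3 H3].
destruct (expsym_cvg g r B 4 Hg Hr HB) as [e4 H4].
exists e1, e2, e3, e4.
assert (HS : is_lim_seq (fun N => expsym g r N 1 ^ 2 - 2 * expsym g r N 2) (e1 ^ 2 - 2 * e2)).
{ apply is_lim_seq_minus'; [|apply (is_lim_seq_scal_l _ 2 e2), H2].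
  simpl. apply is_lim_seq_mult'; [exact H1|].
  apply is_lim_seq_mult'; [exact H1 | apply is_lim_seq_const]. }
assert (HS3 : is_lim_seq (fun N => expsym g r N 1 ^ 3 - 3 * expsym g r N 1 * expsym g r N 2
     + 3 * expsym g r N 3) (e1 ^ 3 - 3 * e1 * e2 + 3 * e3)).
{ apply is_lim_seq_plus'; [|apply (is_lim_seq_scal_l _ 3 e3), H3].
  apply is_lim_seq_minus'.
  - simpl. do 3 (apply is_lim_seq_mult'; [exact H1|]). apply is_lim_seq_const.
  - apply is_lim_seq_mult'; [|exact H2].
    apply (is_lim_seq_scal_l _ 3 e1), H1. }
assert (HT : forall x, is_lim_seq (fun N => 1 - expsym g r N 1 * x + expsym g r N 2 * x ^ 2
     - expsym g r N 3 * x ^ 3) (1 - e1 * x + e2 * x ^ 2 - e3 * x ^ 3)).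
{ intros x. apply is_lim_seq_minus'; [apply is_lim_seq_plus'; [apply is_lim_seq_minus'|]|];
    try apply is_lim_seq_mult'; first [assumption | apply is_lim_seq_const]. }
repeat split.
- apply (is_lim_seq_le (fun _ => 0) _ 0 _
    (fun N => proj1 (expsym_power_sums g r N 0 Hg Hr)) (is_lim_seq_const 0) HS).
- intros t.
  apply (is_lim_seq_le (fun _ => 0) _ 0 (Finite _)
    (fun N => proj2 (expsym_power_sums g r N t Hg Hr)) (is_lim_seq_const 0)).
  apply is_lim_seq_plus'; [|exact HS3].
  apply is_lim_seq_minus'; apply is_lim_seq_mult'; first [assumption | apply is_lim_seq_const].
- intros M HM.
  apply (is_lim_seq_le _ _ (Finite _) (Finite _)
     (fun N => expsym_sum_squares_le g r N M Hg (fun k => conj (Hr k) (HM k))) HS).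
  apply (is_lim_seq_scal_l _ M e1), H1.
- apply (is_lim_seq_le _ _ (Finite _) (Finite _)
     (fun N => proj1 (bonferroni g r N x Hg Hr H H0)) (HT x) (HF x H)).
- apply (is_lim_seq_le _ _ (Finite _) (Finite _)
     (fun N => proj2 (bonferroni g r N x Hg Hr H H0)) (HF x H)).
  apply is_lim_seq_plus'; [apply HT|].
  apply is_lim_seq_mult'; [exact H4 | apply is_lim_seq_const].
Qed.

(** The terms tend to [0], so from some index on they lie below [r k0], and a maximum over an
    initial segment that is at least [r k0] is global. *)
Lemma Rsum_bounded_max r B k0 :
  (forall k, 0 <= r k) -> (forall N, Rsum r N <= B) -> 0 < r k0 ->
  exists m, 0 < r m /\ forall k, r k <= r m.
Proof.
intros Hr HB H0.
destruct (ex_finite_lim_seq_incr (Rsum r) B) as [l Hl].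
{ intros N; simpl; specialize (Hr N); lra. }
{ exact HB. }
assert (Hz : is_lim_seq r 0).
{ apply is_lim_seq_ext with (fun N => Rsum r (S N) - Rsum r N).
  { intros N; simpl; ring. }
  replace 0 with (l - l) by ring.
  apply is_lim_seq_minus'; [apply (is_lim_seq_incr_1 (Rsum r)) |]; exact Hl. }
apply is_lim_seq_spec in Hz. destruct (Hz (mkposreal _ H0)) as [N HN].
assert (Hmax : forall n, exists m, r k0 <= r m /\ forall k, (k < n)%nat -> r k <= r m).
{ induction n as [|n [m [Hm1 Hm2]]].
  - exists k0; split; [lra | intros; lia].
  - destruct (Rle_lt_dec (r n) (r m)) as [Hle|Hlt].
    + exists m; split; [assumption|]. intros k Hk.
      destruct (Nat.eq_dec k n) as [->|]; [assumption | apply Hm2; lia].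
    + exists n; split; [lra|]. intros k Hk.
      destruct (Nat.eq_dec k n) as [->|]; [lra|].
      left; eapply Rle_lt_trans; [apply Hm2; lia | assumption]. }
destruct (Hmax N) as [m [Hm1 Hm2]].
exists m; split; [lra|]. intros k.
destruct (Nat.lt_ge_cases k N) as [Hk|Hk]; [auto|].
specialize (HN k Hk). simpl in HN.
rewrite Rminus_0_r, Rabs_pos_eq in HN by apply Hr. lra.
Qed.

(** * Comparison of Taylor coefficients at the origin *)

Lemma alternating_series_taylor_3 (a : nat -> R) (s v x : R) :
  (forall k, 0 <= a k) -> is_series a s -> 0 <= x <= 1 ->
  is_series (fun k => a k * (- x) ^ k) v ->
  Rabs (v - (a 0%nat - a 1%nat * x + a 2%nat * x ^ 2 - a 3%nat * x ^ 3)) <= s * x ^ 4.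
Proof.
intros Ha Hs [Hx0 Hx1] Hv.
set (T := a 0%nat - a 1%nat * x + a 2%nat * x ^ 2 - a 3%nat * x ^ 3).
assert (Hx4 : 0 <= x ^ 4) by (apply pow_le; lra).
(* The shift by [3] makes the sum for [n = 0] exactly [T]; each later term has degree at least [4]
   and is at most [a k * x ^ 4] in absolute value because [x <= 1]. *)
assert (Hn : forall n, Rabs (sum_n (fun k => a k * (- x) ^ k) (n + 3) - T)
    <= sum_n a (n + 3) * x ^ 4).
{ induction n as [|n IH].
  - simpl Nat.add. rewrite !sum_Sn, !sum_O. unfold plus; simpl plus.
    match goal with |- Rabs ?X <= _ => replace X with 0 by (unfold T; simpl; ring) end.
    rewrite Rabs_R0.
    apply Rmult_le_pos; [|assumption].
    pose proof (Ha 0%nat); pose proof (Ha 1%nat); pose proof (Ha 2%nat); pose proof (Ha 3%nat).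
    simpl; lra.
  - change (S n + 3)%nat with (S (n + 3)). rewrite !sum_Sn. unfold plus; simpl.
    set (P := sum_n _ (n + 3)) in *. set (Q := sum_n a (n + 3)) in *.
    set (d := a (S (n + 3)) * (- x * (- x) ^ (n + 3))).
    assert (Hd : Rabs d <= a (S (n + 3)) * x ^ 4).
    { unfold d. change (- x * (- x) ^ (n + 3)) with ((- x) ^ (S (n + 3))).
      rewrite Rabs_mult, (Rabs_pos_eq (a _)) by apply Ha.
      apply Rmult_le_compat_l; [apply Ha|].
      rewrite <- RPow_abs, Rabs_Ropp, (Rabs_pos_eq x) by assumption.
      replace (S (n + 3)) with (n + 4)%nat by lia. rewrite pow_add.
      rewrite <- (Rmult_1_l (x ^ 4)) at 2. apply Rmult_le_compat_r; [assumption|].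
      rewrite <- (pow1 n). apply pow_incr; lra. }
    replace (P + d - T) with ((P - T) + d) by ring.
    eapply Rle_trans; [apply Rabs_triang|]. simpl in *. lra. }
apply (is_lim_seq_le (fun n => Rabs (sum_n (fun k => a k * (- x) ^ k) (n + 3) - T))
   (fun n => sum_n a (n + 3) * x ^ 4) (Finite _) (Finite _) Hn).
- apply (is_lim_seq_abs _ (Finite (v - T))). apply is_lim_seq_minus'; [|apply is_lim_seq_const].
  apply (is_lim_seq_incr_n (sum_n (fun k => a k * (- x) ^ k)) 3). exact Hv.
- apply is_lim_seq_mult'; [|apply is_lim_seq_const].
  apply (is_lim_seq_incr_n (sum_n a) 3). exact Hs.
Qed.

Lemma eq_0_of_small_multiples (d K h : R) :
  0 < h -> (forall x, 0 < x <= h -> Rabs d <= K * x) -> d = 0.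
Proof.
intros Hh H. apply Rabs_eq_0. apply Rle_antisym; [|apply Rabs_pos].
apply (is_lim_seq_le (fun _ => Rabs d) (fun n => K * (h * / (INR n + 1))) (Finite _) 0).
- intros n. apply H. pose proof (pos_INR n).
  assert (0 < / (INR n + 1)) by (apply Rinv_0_lt_compat; lra).
  assert (/ (INR n + 1) <= 1) by (rewrite <- Rinv_1; apply Rinv_le_contravar; lra).
  split; nra.
- apply is_lim_seq_const.
- replace 0 with (K * (h * 0)) by ring.
  apply (is_lim_seq_scal_l _ K (h * 0)), (is_lim_seq_scal_l _ h 0).
  apply is_lim_seq_ext with (fun n => / INR (S n)).
  { intros n; now rewrite S_INR. }
  apply (is_lim_seq_incr_1 (fun n => / INR n)).
  replace (Finite 0) with (Rbar_inv p_infty) by reflexivity.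
  apply is_lim_seq_inv; [apply is_lim_seq_INR | discriminate].
Qed.

(** The coefficients are eliminated from the lowest degree upwards, dividing each time by the lowest
    power of [x] that is left. *)
Lemma cubic_eq_0_of_quartic_bound (d1 d2 d3 K h : R) :
  0 < h -> 0 <= K ->
  (forall x, 0 < x <= h -> Rabs (d1 * x + d2 * x ^ 2 + d3 * x ^ 3) <= K * x ^ 4) ->
  d1 = 0 /\ d2 = 0 /\ d3 = 0.
Proof.
intros Hh HK H.
assert (step : forall d d' d'' h', 0 < h' -> h' <= 1 ->
   (forall x, 0 < x <= h' -> Rabs (d + d' * x + d'' * x ^ 2) <= K * x) -> d = 0).
{ intros d d' d'' h' Hh' Hh1 Hb.
  apply eq_0_of_small_multiples with (K + Rabs d' + Rabs d'') h'; [assumption|].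
  intros x Hx. specialize (Hb x Hx).
  replace d with ((d + d' * x + d'' * x ^ 2) + (- (d' * x) + - (d'' * x ^ 2))) by ring.
  eapply Rle_trans; [apply Rabs_triang|].
  eapply Rle_trans; [apply Rplus_le_compat_l, Rabs_triang|].
  rewrite !Rabs_Ropp, !Rabs_mult, (Rabs_pos_eq (x ^ 2)), (Rabs_pos_eq x) by nra.
  pose proof (Rabs_pos d''). assert (x ^ 2 <= x) by nra. nra. }
set (h' := Rmin h 1).
assert (Hh' : 0 < h') by (apply Rmin_glb_lt; lra).
assert (Hh1 : h' <= 1) by apply Rmin_r.
assert (Hh2 : h' <= h) by apply Rmin_l.
assert (div : forall u n x, 0 < x <= h' -> Rabs (u * x ^ n) <= K * x * x ^ n -> Rabs u <= K * x).
{ intros u n x Hx Hu. assert (0 < x ^ n) by (apply pow_lt; lra).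
  rewrite Rabs_mult, (Rabs_pos_eq (x ^ n)) in Hu by lra.
  apply Rmult_le_reg_r with (x ^ n); assumption. }
assert (E1 : d1 = 0).
{ apply step with d2 d3 h'; try assumption. intros x Hx.
  apply (div _ 1%nat); [assumption|].
  replace ((d1 + d2 * x + d3 * x ^ 2) * x ^ 1) with (d1 * x + d2 * x ^ 2 + d3 * x ^ 3) by ring.
  eapply Rle_trans; [apply H; lra|].
  replace (K * x * x ^ 1) with (K * x ^ 2 * 1) by ring.
  replace (K * x ^ 4) with (K * x ^ 2 * x ^ 2) by ring.
  apply Rmult_le_compat_l; nra. }
subst d1.
assert (E2 : d2 = 0).
{ apply step with d3 0 h'; try assumption. intros x Hx.
  apply (div _ 2%nat); [assumption|].
  replace ((d2 + d3 * x + 0 * x ^ 2) * x ^ 2) with (0 * x + d2 * x ^ 2 + d3 * x ^ 3) by ring.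
  eapply Rle_trans; [apply H; lra|].
  replace (K * x * x ^ 2) with (K * x ^ 3 * 1) by ring.
  replace (K * x ^ 4) with (K * x ^ 3 * x) by ring.
  apply Rmult_le_compat_l; [|lra]. apply Rmult_le_pos; [lra | apply pow_le; lra]. }
subst d2.
repeat split. apply step with 0 0 h'; try assumption. intros x Hx.
apply (div _ 3%nat); [assumption|].
replace ((d3 + 0 * x + 0 * x ^ 2) * x ^ 3) with (0 * x + 0 * x ^ 2 + d3 * x ^ 3) by ring.
replace (K * x * x ^ 3) with (K * x ^ 4) by ring. apply H; lra.
Qed.

(** * The bound for functions in product form *)

Lemma Rprod_eq_0 u m N : u m = 0 -> (m < N)%nat -> Rprod u N = 0.
Proof.
intros Hu; induction N as [|N IH]; intros HN; [lia|]. simpl.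
destruct (Nat.eq_dec m N) as [->|]; [rewrite Hu | rewrite IH by lia]; ring.
Qed.

Lemma term_le_Rsum r k : (forall k, 0 <= r k) -> r k <= Rsum r (S k).
Proof. intros Hr; simpl. pose proof (Rsum_ge_0 r k Hr). lra. Qed.

Lemma q3_le_of_product (a r : nat -> R) (F : R -> R) (g B : R) :
  (forall k, 0 < a k) ->
  (forall x, is_series (fun k => a k * x ^ k) (F x)) ->
  0 <= g -> (forall k, 0 <= r k) -> (forall N, Rsum r N <= B) ->
  (forall x, 0 <= x ->
     is_lim_seq (fun N => exp (- g * x) * Rprod (fun k => 1 - r k * x) N) (F (- x) / a 0%nat)) ->
  let q2 := second_quotient a 2 in
  let q3 := second_quotient a 3 in
  q2 < 4 -> q2 <= q3 ->
  q3 <= (- q2 * (2 * q2 - 9) + 2 * (q2 - 3) * sqrt (q2 * (q2 - 3))) / (q2 * (4 - q2)).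
Proof.
intros Ha HF Hg Hr HB HG q2 q3 Hq4 Hq23.
destruct (expsym_limits g r B (fun x => F (- x) / a 0%nat) Hg Hr HB HG)
  as (e1 & e2 & e3 & e4 & HS2 & HCS & HM & HT).
pose proof (Ha 0%nat) as Ha0. pose proof (Ha 1%nat) as Ha1.
pose proof (Ha 2%nat) as Ha2. pose proof (Ha 3%nat) as Ha3.
assert (HF1 : is_series a (F 1)).
{ apply is_series_ext with (2 := HF 1). intros k; rewrite pow1; apply Rmult_1_r. }
assert (HF1pos : 0 <= F 1).
{ apply (is_lim_seq_le (fun _ => 0) (sum_n a) 0 (F 1)); [|apply is_lim_seq_const | exact HF1].
  induction n as [|n IH]; [rewrite sum_O; auto with real|].
  rewrite sum_Sn; unfold plus; simpl. specialize (Ha (S n)); lra. }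
assert (HB0 : 0 <= B) by (apply Rle_trans with (2 := HB O), Rle_refl).
(* Two cubic approximations of [F (- x) / a 0], one from the power series and one from Bonferroni,
   each have error of order [x ^ 4]. On [0 < x <= / (B + 1)] both apply, since there [x <= 1] and
   [r k * x <= 1]. *)
assert (Hmatch : e1 = a 1%nat / a 0%nat /\ e2 = a 2%nat / a 0%nat /\ e3 = a 3%nat / a 0%nat).
{ destruct (cubic_eq_0_of_quartic_bound (e1 - a 1%nat / a 0%nat) (a 2%nat / a 0%nat - e2)
    (e3 - a 3%nat / a 0%nat) (Rabs e4 + F 1 / a 0%nat) (/ (B + 1))) as (D1 & D2 & D3);
    [apply Rinv_0_lt_compat; lra | | | lra].
  { apply Rplus_le_le_0_compat; [apply Rabs_pos|].
    apply Rmult_le_pos; [lra | left; apply Rinv_0_lt_compat; lra]. }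
  intros x [Hx0 Hx1].
  assert (HxB : x * (B + 1) <= 1).
  { apply Rmult_le_reg_r with (/ (B + 1)); [apply Rinv_0_lt_compat; lra|].
    rewrite Rmult_assoc, Rinv_r by lra. lra. }
  assert (Hrx : forall k, r k * x <= 1).
  { intros k. pose proof (Rle_trans _ _ _ (term_le_Rsum r k Hr) (HB (S k))). nra. }
  destruct (HT x (Rlt_le _ _ Hx0) Hrx) as [HT1 HT2].
  assert (Hx4 : 0 <= x ^ 4) by (apply pow_le; lra).
  assert (HA : Rabs (F (- x) - (a 0%nat - a 1%nat * x + a 2%nat * x ^ 2 - a 3%nat * x ^ 3))
     <= F 1 * x ^ 4).
  { apply alternating_series_taylor_3; [auto with real | exact HF1 | split; nra | apply HF]. }
  set (v := F (- x)) in *. set (Ta := a 0%nat - _ + _ - _) in *.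
  set (Te := 1 - e1 * x + e2 * x ^ 2 - e3 * x ^ 3) in *.
  replace (_ + _ + _) with ((v / a 0%nat - Te) + - ((v - Ta) / a 0%nat))
    by (unfold Te, Ta; field; lra).
  eapply Rle_trans; [apply Rabs_triang|].
  rewrite Rabs_Ropp, Rmult_plus_distr_r. apply Rplus_le_compat.
  - rewrite Rabs_pos_eq by lra. pose proof (Rle_abs e4). nra.
  - unfold Rdiv at 1. rewrite Rabs_mult, (Rabs_pos_eq (/ a 0%nat))
      by (left; apply Rinv_0_lt_compat; lra).
    replace (F 1 / a 0%nat * x ^ 4) with (F 1 * x ^ 4 * / a 0%nat) by (field; lra).
    apply Rmult_le_compat_r; [left; apply Rinv_0_lt_compat; lra | exact HA]. }
destruct Hmatch as (E1 & E2 & E3).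
assert (P1 : 0 < e1) by (rewrite E1; apply Rdiv_lt_0_compat; lra).
assert (P2 : 0 < e2) by (rewrite E2; apply Rdiv_lt_0_compat; lra).
assert (P3 : 0 < e3) by (rewrite E3; apply Rdiv_lt_0_compat; lra).
assert (Q2 : q2 = e1 ^ 2 / e2).
{ rewrite E1, E2. unfold q2, second_quotient. simpl Nat.sub. field; repeat split; lra. }
assert (Q3 : q3 = e2 ^ 2 / (e1 * e3)).
{ rewrite E1, E2, E3. unfold q3, second_quotient. simpl Nat.sub. field; repeat split; lra. }
assert (H3 : 3 <= q2).
{ rewrite Q2. apply second_quotient_ge_3 with e3; try assumption. rewrite <- Q2, <- Q3; exact Hq23. }
assert (Hsq : e1 ^ 2 - 2 * e2 = e2 * (q2 - 2)) by (rewrite Q2; field; lra).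
(* Without a positive [r k] the sum of squares would be at most [0], whereas it equals
   [e2 * (q2 - 2)] with [q2 >= 3]. *)
assert (Hex : exists k, 0 < r k).
{ apply not_all_not_ex. intros Hno.
  assert (H0 := HM 0 (fun k => Rnot_lt_le _ _ (Hno k))). nra. }
destruct Hex as [k0 Hk0].
destruct (Rsum_bounded_max r B k0 Hr HB Hk0) as [m [Hm Hmax]].
set (x := / r m).
assert (Hrmx : r m * x = 1) by (apply Rinv_r; lra).
assert (Hx : 0 < x) by (apply Rinv_0_lt_compat; lra).
assert (Hz : F (- x) / a 0%nat = 0).
{ assert (Hu := is_lim_seq_unique _ _ (HG x (Rlt_le _ _ Hx))).
  rewrite (Lim_seq_ext_loc _ (fun _ => 0)), Lim_seq_const in Hu.
  - now injection Hu.
  - exists (S m); intros N HN. rewrite (Rprod_eq_0 _ m); [ring | lra | lia]. }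
assert (HQ : 1 - e1 * x + e2 * x ^ 2 - e3 * x ^ 3 <= 0).
{ rewrite <- Hz. apply HT; [lra|]. intros k. rewrite <- Hrmx.
  apply Rmult_le_compat_r; [lra | apply Hmax]. }
apply cubic_at_small_root_bound with (e2 * x / e1); [lra | split |].
- apply Rdiv_lt_0_compat; [nra | lra].
(* The sum of squares [e2 * (q2 - 2)] is at most [r m * e1], and [q2 >= 3]; hence
   [e2 <= e1 * r m]. *)
- apply Rmult_le_reg_r with (e1 * r m); [nra|].
  replace (e2 * x / e1 * (e1 * r m)) with (e2 * (r m * x)) by (field; lra).
  rewrite Hrmx. assert (H0 := HM _ Hmax). nra.
- replace (1 - q2 * (e2 * x / e1) + q2 * (e2 * x / e1) ^ 2) with (1 - e1 * x + e2 * x ^ 2)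
    by (rewrite Q2; field; lra).
  replace (q2 * (e2 * x / e1) ^ 3) with (q3 * (e3 * x ^ 3))
    by (rewrite Q2, Q3; field; lra).
  apply Rmult_le_compat_l; lra.
Qed.

(** * Laguerre-Pólya products on the real axis *)

Lemma Rprod_ext u v N : (forall k, u k = v k) -> Rprod u N = Rprod v N.
Proof. intros H; induction N as [|N IH]; simpl; [|rewrite IH, H]; reflexivity. Qed.

Lemma Rprod_mult_exp u r x N :
  Rprod (fun k => u k * exp (r k * x)) N = Rprod u N * exp (Rsum r N * x).
Proof.
induction N as [|N IH]; simpl.
- rewrite Rmult_0_l, exp_0; ring.
- rewrite IH, Rmult_plus_distr_r, exp_plus; ring.
Qed.

(* As the product decreases in [N], a function that stays above [1] cannot have
   a Gaussian factor, nor zeros whose reciprocals sum to more than [beta]. *)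
Lemma growth_bounds (r : nat -> R) (alpha beta : R) (p : R -> R) :
  0 <= alpha -> (forall k, 0 <= r k) ->
  (forall t, is_lim_seq (fun N => Rprod (fun k => (1 + r k * t) * exp (- r k * t)) N) (p t)) ->
  (forall t, 0 <= t -> 1 <= exp (- alpha * t ^ 2 + beta * t) * p t) ->
  alpha = 0 /\ forall N, Rsum r N <= beta.
Proof.
intros Halpha Hr Hp Hf.
(* This rests on [eta * (1 + s) <= 1 + eta * s <= exp (eta * s)]. Taking [eta = 1] gives
   [(1 + s) * exp (- s) <= 1]; a small [eta] keeps almost the full decay rate at the cost of a
   constant. *)
assert (Hfac : forall eta s, 0 < eta <= 1 -> 0 <= s ->
   0 <= (1 + s) * exp (- s) <= exp (- ln eta - (1 - eta) * s)).
{ intros eta s Heta Hs. split; [pose proof (exp_pos (- s)); nra|].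
  replace (- ln eta - (1 - eta) * s) with (- ln eta + (eta * s + - s)) by ring.
  rewrite !exp_plus, (exp_Ropp (ln eta)), exp_ln, <- Rmult_assoc by lra.
  apply Rmult_le_compat_r; [left; apply exp_pos|].
  apply Rmult_le_reg_l with eta; [lra|].
  rewrite <- Rmult_assoc, Rinv_r by lra.
  pose proof (exp_ineq1_le (eta * s)). nra. }
assert (Hprod : forall eta t N, 0 < eta <= 1 -> 0 <= t ->
   0 <= Rprod (fun k => (1 + r k * t) * exp (- r k * t)) N
     <= exp (INR N * - ln eta - (1 - eta) * (Rsum r N * t))).
{ intros eta t N Heta Ht. induction N as [|N IH].
  - simpl. rewrite !Rmult_0_l, Rmult_0_r, Rminus_0_r, exp_0; lra.
  - simpl Rprod. simpl Rsum. rewrite S_INR.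
    destruct (Hfac eta (r N * t) Heta (Rmult_le_pos _ _ (Hr N) Ht)) as [H1 H2].
    rewrite Ropp_mult_distr_l in H1, H2.
    replace (_ - _) with ((INR N * - ln eta - (1 - eta) * (Rsum r N * t))
      + (- ln eta - (1 - eta) * (r N * t))) by ring.
    rewrite exp_plus. split; [apply Rmult_le_pos | apply Rmult_le_compat]; tauto. }
assert (Hle : forall t N, 0 <= t -> p t <= Rprod (fun k => (1 + r k * t) * exp (- r k * t)) N).
{ intros t N Ht. apply (is_lim_seq_decr_compare _ _ (Hp t)).
  intros n. simpl.
  destruct (Hfac 1 (r n * t)) as [H1 H2]; [lra | apply Rmult_le_pos; auto|].
  rewrite ln_1, Rminus_diag, Rmult_0_l, Ropp_0, Rminus_0_r, exp_0, Ropp_mult_distr_l in H2.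
  destruct (Hprod 1 t n) as [H3 _]; [lra | assumption |]. nra. }
assert (Hexp : forall eta t N, 0 < eta <= 1 -> 0 <= t ->
  0 <= - alpha * t ^ 2 + beta * t + (INR N * - ln eta - (1 - eta) * (Rsum r N * t))).
{ intros eta t N Heta Ht. apply Rnot_lt_le; intros Hn.
  apply exp_increasing in Hn. rewrite exp_0, exp_plus in Hn.
  specialize (Hf t Ht). specialize (Hle t N Ht). specialize (Hprod eta t N Heta Ht).
  pose proof (exp_pos (- alpha * t ^ 2 + beta * t)). nra. }
assert (Hab : forall t, 0 < t -> alpha * t <= beta).
{ intros t Ht. specialize (Hexp 1 t O). rewrite ln_1 in Hexp. simpl in Hexp.
  apply Rmult_le_reg_r with t; [assumption|]. lra. }
assert (Ha0 : alpha = 0).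
{ destruct Halpha as [Hpos|]; [exfalso | auto].
  assert (Hb : 0 < beta) by (specialize (Hab 1); lra).
  specialize (Hab ((beta + 1) / alpha) ltac:(apply Rdiv_lt_0_compat; lra)).
  replace (alpha * ((beta + 1) / alpha)) with (beta + 1) in Hab by (field; lra). lra. }
split; [exact Ha0|]. subst alpha.
assert (Hb : 0 <= beta) by (specialize (Hab 1); lra).
intros N. apply Rnot_lt_le; intros Hn.
(* Write [L = INR N * - ln eta]. This [eta] turns the exponent in [Hexp] into
   [L - (S - beta) * t / 2], and the [t] chosen below makes it [-1]. *)
set (S := Rsum r N) in *. set (eta := (S - beta) / (2 * S)).
assert (HeS : eta * S = (S - beta) / 2) by (unfold eta; field; lra).
assert (Heta : 0 < eta <= 1).
{ split; [apply Rdiv_lt_0_compat; lra|]. apply Rmult_le_reg_r with S; lra. }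
assert (HL : 0 <= INR N * - ln eta).
{ apply Rmult_le_pos; [apply pos_INR|].
  pose proof (ln_le eta 1 (proj1 Heta) (proj2 Heta)) as H. rewrite ln_1 in H; lra. }
set (t := 2 * (INR N * - ln eta + 1) / (S - beta)).
assert (Ht : 0 < t) by (apply Rdiv_lt_0_compat; lra).
assert (HtS : (S - beta) * t = 2 * (INR N * - ln eta + 1)) by (unfold t; field; lra).
specialize (Hexp eta t N Heta (Rlt_le _ _ Ht)). fold S in Hexp.
assert (eta * S * t = INR N * - ln eta + 1) by (rewrite HeS; lra).
nra.
Qed.

(** The value [F 0 = a 0 > 0] forces [n = 0] and [c = a 0]. As [F >= a 0] on the positive axis, the
    growth bounds remove the Gaussian factor and make the [r k] summable, so the convergence factors
    can be merged into one exponential. *)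
Lemma q3_le_of_real_LP (a r : nat -> R) (F p : R -> R) (c alpha beta : R) (n : nat) :
  (forall k, 0 < a k) ->
  (forall x, is_series (fun k => a k * x ^ k) (F x)) ->
  0 <= alpha ->
  (forall t, is_lim_seq (fun N => Rprod (fun k => (1 + r k * t) * exp (- r k * t)) N) (p t)) ->
  (forall t, F t = c * t ^ n * exp (- alpha * t ^ 2 + beta * t) * p t) ->
  let q2 := second_quotient a 2 in
  let q3 := second_quotient a 3 in
  q2 < 4 -> q2 <= q3 ->
  q3 <= (- q2 * (2 * q2 - 9) + 2 * (q2 - 3) * sqrt (q2 * (q2 - 3))) / (q2 * (4 - q2)).
Proof.
intros Ha HF Halpha Hp Hprod.
pose proof (Ha 0%nat) as Ha0.
assert (HFge : forall t, 0 <= t -> a 0%nat <= F t).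
{ intros t Ht.
  apply (is_lim_seq_le (fun _ => a 0%nat) (sum_n (fun k => a k * t ^ k)) (a 0%nat) (F t));
    [|apply is_lim_seq_const | apply HF].
  induction n0 as [|m IH]; [rewrite sum_O; simpl; lra|].
  rewrite sum_Sn; unfold plus; simpl AbelianMonoid.plus.
  pose proof (Ha (S m)). pose proof (pow_le t (S m) Ht) as H1. simpl in *. nra. }
assert (HF0 : F 0 = a 0%nat).
{ assert (H := is_series_unique _ _ (HF 0)). rewrite <- H.
  apply is_series_unique, (is_lim_seq_ext (fun _ => a 0%nat) _ (Finite (a 0%nat)));
    [|apply is_lim_seq_const].
  induction n0 as [|m IH]; [rewrite sum_O; simpl; ring|].
  rewrite sum_Sn, <- IH; unfold plus; simpl; ring. }
assert (Hp0 : p 0 = 1).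
{ assert (H := is_lim_seq_unique _ _ (Hp 0)).
  rewrite (Lim_seq_ext _ (fun _ => 1)), Lim_seq_const in H; [now injection H|].
  induction n0 as [|m IH]; [reflexivity|]. simpl. rewrite IH, !Rmult_0_r, exp_0; ring. }
assert (Hn : n = O).
{ destruct n as [|m]; [reflexivity|exfalso].
  specialize (Hprod 0). rewrite HF0 in Hprod. simpl in Hprod. lra. }
subst n.
assert (Hc : c = a 0%nat).
{ rewrite <- HF0, Hprod, Hp0. simpl. rewrite !Rmult_0_l, !Rmult_0_r, Rplus_0_r, exp_0. ring. }
(* A negative [r k] would give [F] a zero at the positive point [/ - r k]. *)
assert (Hr : forall k, 0 <= r k).
{ intros k. apply Rnot_lt_le; intros Hk.
  assert (Ht : 0 < / - r k) by (apply Rinv_0_lt_compat; lra).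
  set (t := / - r k) in *.
  assert (H := is_lim_seq_unique _ _ (Hp t)).
  rewrite (Lim_seq_ext_loc _ (fun _ => 0)), Lim_seq_const in H.
  - injection H as H. specialize (HFge t (Rlt_le _ _ Ht)).
    rewrite Hprod, <- H in HFge. lra.
  - exists (S k); intros N HN. apply (Rprod_eq_0 _ k); [|lia].
    replace (1 + r k * t) with 0 by (unfold t; field; lra). ring. }
destruct (growth_bounds r alpha beta p Halpha Hr Hp) as [H0 HS].
{ intros t Ht. specialize (HFge t Ht). rewrite Hprod, Hc in HFge. rewrite pow_O in HFge.
  apply Rmult_le_reg_l with (a 0%nat); [assumption|]. lra. }
subst alpha c.
destruct (ex_finite_lim_seq_incr (Rsum r) beta) as [l Hl];
  [intros N; simpl; specialize (Hr N); lra | exact HS|].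
assert (Hlb : l <= beta).
{ apply (is_lim_seq_le _ _ (Finite l) (Finite beta) HS Hl (is_lim_seq_const beta)). }
(* With [l] the sum of the [r k], the factors [exp (r k * x)] combine with [exp (- beta * x)] to
   [exp (- (beta - l) * x)], up to the correction [exp ((l - Rsum r N) * x)], which tends to [1]. *)
apply (q3_le_of_product a r F (beta - l) beta Ha HF); [lra | exact Hr | exact HS |].
intros x Hx.
apply is_lim_seq_ext with (fun N => exp (- beta * x)
   * Rprod (fun k => (1 + r k * - x) * exp (- r k * - x)) N * exp ((l - Rsum r N) * x)).
{ intros N.
  rewrite (Rprod_ext _ (fun k => (1 - r k * x) * exp (r k * x)))
    by (intros k; f_equal; [ring | f_equal; ring]).
  rewrite Rprod_mult_exp.
  replace (- (beta - l) * x) with (- beta * x + (Rsum r N * x + (l - Rsum r N) * x)) by ring.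
  rewrite !exp_plus; ring. }
replace (F (- x) / a 0%nat) with (exp (- beta * x) * p (- x) * 1).
2:{ rewrite Hprod. simpl. replace (- 0 * _ + _) with (- beta * x) by ring. field; lra. }
apply is_lim_seq_mult'; [apply is_lim_seq_mult'; [apply is_lim_seq_const | apply Hp]|].
rewrite <- exp_0.
apply is_lim_seq_continuous; [apply derivable_continuous_pt, derivable_pt_exp|].
replace 0 with ((l - l) * x) by ring.
apply is_lim_seq_mult'; [|apply is_lim_seq_const].
apply is_lim_seq_minus'; [apply is_lim_seq_const | exact Hl].
Qed.

(** * Passage from the complex plane to the real axis *)

Lemma filterlim_Re (u : nat -> C) (l : C) :
  filterlim u eventually (locally l) -> is_lim_seq (fun n => Re (u n)) (Re l).
Proof.
intros H. apply (filterlim_comp _ _ _ u Re _ (locally l)); [exact H|].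
destruct l as [x y]. exact (@continuous_fst R_UniformSpace R_UniformSpace x y).
Qed.

Lemma filterlim_Im (u : nat -> C) (l : C) :
  filterlim u eventually (locally l) -> is_lim_seq (fun n => Im (u n)) (Im l).
Proof.
intros H. apply (filterlim_comp _ _ _ u Im _ (locally l)); [exact H|].
destruct l as [x y]. exact (@continuous_snd R_UniformSpace R_UniformSpace x y).
Qed.

Lemma Cexp_RtoC (s : R) : Cexp s = RtoC (exp s).
Proof. unfold Cexp, RtoC; simpl. rewrite cos_0, sin_0. f_equal; ring. Qed.

Lemma LP_factor_RtoC (x t : R) : x <> 0 ->
  LP_factor x t = RtoC ((1 + - / x * t) * exp (- (- / x) * t)).
Proof.
intros Hx. unfold LP_factor.
rewrite <- RtoC_div, Cexp_RtoC, <- RtoC_minus, <- RtoC_mult by assumption.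
f_equal. f_equal; [|f_equal]; field; assumption.
Qed.

Lemma Cprod_RtoC (u : nat -> C) (v : nat -> R) N :
  (forall k, (k < N)%nat -> u k = RtoC (v k)) -> Cprod u N = RtoC (Rprod v N).
Proof.
intros H; induction N as [|N IH]; simpl; [reflexivity|].
rewrite IH, H, <- RtoC_mult; [reflexivity | lia | intros; apply H; lia].
Qed.

Lemma LP_product_RtoC (P : C -> C) :
  finite_LP_product P \/ infinite_LP_product P ->
  exists r : nat -> R, forall t : R,
    P (RtoC t) = RtoC (Re (P (RtoC t))) /\
    is_lim_seq (fun N => Rprod (fun k => (1 + r k * t) * exp (- r k * t)) N) (Re (P (RtoC t))).
Proof.
intros [(N & x & Hx & HP) | (x & Hx & _ & HP)].
(* Padding with [0] adds factors equal to [1], so the partial products are constant from [N] on and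
   a finite product becomes a limit too. *)
- exists (fun k => if Nat.ltb k N then - / x k else 0). intros t.
  set (v := fun k => (1 + (if Nat.ltb k N then - / x k else 0) * t) * _).
  assert (E : P (RtoC t) = RtoC (Rprod v N)).
  { rewrite HP. apply Cprod_RtoC. intros k Hk. rewrite LP_factor_RtoC by auto.
    unfold v. now rewrite (proj2 (Nat.ltb_lt k N) Hk). }
  rewrite E. split; [reflexivity|]. simpl.
  apply (is_lim_seq_incr_n (Rprod v) N).
  apply is_lim_seq_ext with (fun _ => Rprod v N); [|apply is_lim_seq_const].
  induction n as [|n IH]; [reflexivity|]. simpl. rewrite <- IH. unfold v at 3.
  rewrite (proj2 (Nat.ltb_ge (n + N) N)) by lia.
  replace (- 0 * t) with 0 by ring. rewrite exp_0; ring.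
- exists (fun k => - / x k). intros t.
  set (v := fun k => (1 + - / x k * t) * _).
  assert (E : forall N, Cprod (fun k => LP_factor (x k) t) N = RtoC (Rprod v N)).
  { intros N. apply Cprod_RtoC. intros k _. now apply LP_factor_RtoC. }
  assert (H : filterlim (fun N => RtoC (Rprod v N)) eventually (locally (P (RtoC t)))).
  { exact (filterlim_ext _ _ E (HP (RtoC t))). }
  split; [|exact (filterlim_Re _ _ H)].
  (* The partial products are real, so the imaginary part of their limit is [0]. *)
  apply filterlim_Im in H. simpl in H. apply is_lim_seq_unique in H.
  rewrite Lim_seq_const in H. injection H as H.
  rewrite (surjective_pairing (P (RtoC t))) at 1. unfold Im in H. now rewrite <- H.
Qed.

Lemma is_entire_series_Re (a : nat -> R) (f : C -> C) (t : R) :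
  is_entire_series a f -> is_series (fun k => a k * t ^ k) (Re (f (RtoC t))).
Proof.
intros H. specialize (H (RtoC t)).
assert (E : forall n, sum_n (fun k => scal (pow_n (K := C_AbsRing) (RtoC t) k)
    (RtoC (a k) : C_NormedModule)) n
    = (RtoC (sum_n (fun k => a k * t ^ k) n) : C_NormedModule)).
{ assert (Hp : forall k, pow_n (K := C_AbsRing) (RtoC t) k = RtoC (t ^ k)).
  { induction k as [|k IH]; [reflexivity|]. simpl. rewrite IH.
    symmetry; apply RtoC_mult. }
  induction n as [|n IH].
  - rewrite !sum_O, Hp. rewrite Rmult_comm. symmetry; apply RtoC_mult.
  - rewrite !sum_Sn, IH, Hp, (Rmult_comm (a _)).
    unfold plus at 2; simpl AbelianMonoid.plus. rewrite RtoC_plus, RtoC_mult. reflexivity. }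
exact (filterlim_Re _ _ (filterlim_ext _ _ E H)).
Qed.

Theorem theorem1p4 :
  forall (a : nat -> R) (f : C -> C),
    (forall k : nat, 0 < a k) ->
    is_entire_series a f ->
    Laguerre_Polya f ->
    let q2 := second_quotient a 2 in
    let q3 := second_quotient a 3 in
    q2 < 4 ->
    q2 <= q3 ->
    q3 <= (- q2 * (2 * q2 - 9) + 2 * (q2 - 3) * sqrt (q2 * (q2 - 3)))
          / (q2 * (4 - q2)).
Proof.
intros a f Ha Hf (_ & c & alpha & beta & n & P & Halpha & HP & Hprod).
destruct (LP_product_RtoC P HP) as [r Hr].
apply (q3_le_of_real_LP a r (fun t => Re (f (RtoC t))) (fun t => Re (P (RtoC t)))
  c alpha beta n Ha); [intros t; now apply is_entire_series_Re | exact Halpha | apply Hr |].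
(* At a real point every factor is real, so the complex factorization restricts to a real one. *)
intros t. rewrite Hprod, (proj1 (Hr t)).
rewrite <- !RtoC_pow, <- RtoC_opp, <- !RtoC_mult, <- RtoC_plus, Cexp_RtoC, <- !RtoC_mult.
reflexivity.
Qed.
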